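(* Let $p$ be a prime. Every $p$-adic self-similar string is lattice; that is, if $\mathcal{L}_p$ is a $p$-adic self-similar string with scaling ratios $r_1,\dots,r_N$, then the multiplicative subgroup of $(0,\infty)$ generated by $r_1,\dots,r_N$ is discrete in $(0,\infty)$.
   Context: $|\cdot|_p$ is normalized by $|p^k|_p=p^{-k}$. An affine similarity contraction mapping of $\mathbb{Z}_p$ is a map $\Phi:\mathbb{Z}_p\to\mathbb{Z}_p$ of the form $\Phi(x)=ax+b$ with $a,b\in\mathbb{Z}_p$, for which there is a real number $r\in(0,1)$ (its scaling ratio) with $|\Phi(x)-\Phi(y)|_p=r|x-y|_p$ for all $x,y\in\mathbb{Z}_p$ (so $r=|a|_p$). A $p$-adic self-similar string is built as follows. Let $N\ge2$ and let $\Phi_1,\dots,\Phi_N$ be affine similarity contraction mappings of $\mathbb{Z}_p$ with scaling ratios $1>r_1\ge\cdots\ge r_N>0$, such that $\sum_{j=1}^N r_j<1$ and the images $\Phi_j(\mathbb{Z}_p)$ are pairwise disjoint. Let $G_1,\dots,G_K$ ($K\ge1$) be the generators, i.e. the convex components (maximal balls contained in the set) of $\mathbb{Z}_p\setminus\bigcup_{j=1}^N\Phi_j(\mathbb{Z}_p)$. The associated $p$-adic self-similar string is the disjoint union of balls $\mathcal{L}_p=\bigcup_{w}\bigcup_{k=1}^K\Phi_w(G_k)$, where $w$ runs over all finite words (including the empty word) on $\{1,\dots,N\}$ and $\Phi_w=\Phi_{w_\alpha}\circ\cdots\circ\Phi_{w_1}$ for $w=(w_1,\dots,w_\alpha)$.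 The string is called lattice if the multiplicative group generated by $r_1,\dots,r_N$ is discrete in $(0,\infty)$. *)

(* Defs.v *)
From HB Require Import structures.
From mathcomp Require Import all_boot all_order all_algebra.
From mathcomp Require Import all_classical all_reals all_analysis.
Set Implicit Arguments.
Unset Strict Implicit.
Unset Printing Implicit Defensive.
Import Order.TTheory GRing.Theory Num.Theory.
Import numFieldNormedType.Exports.
Local Open Scope classical_set_scope.
Local Open Scope ring_scope.

(* [padic_int p] is the inverse limit of the rings Z/p^n: [x n] is the
   canonical representative, in [0, p^n), of the class of [x] modulo p^n.
   The coherence condition forces both the range and the compatibility. *)
Definition coherent (p : nat) (x : nat -> int) : Prop :=
  forall n, x n = (x n.+1 %% (p%:Z ^+ n))%Z.

Record padic_int (p : nat) := PadicInt {
  residue :> nat -> int;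
  _ : `[< coherent p residue >] }.

HB.instance Definition _ (p : nat) := [isSub for @residue p].
HB.instance Definition _ (p : nat) := [Choice of padic_int p by <:].

Definition reduce (p : nat) (u : nat -> int) (n : nat) : int :=
  (u n %% (p%:Z ^+ n))%Z.

Section PadicRing.
Variable p : nat.
Implicit Types x y z : padic_int p.

Lemma residueE x n : x n = (x n.+1 %% (p%:Z ^+ n))%Z.
Proof. by case: x => u /= /asboolP. Qed.

Lemma dvdz_modz_pow (a : int) n :
  ((a %% (p%:Z ^+ n.+1))%Z %% (p%:Z ^+ n))%Z = (a %% (p%:Z ^+ n))%Z.
Proof.
by rewrite [in RHS](divz_eq a (p%:Z ^+ n.+1)) exprS mulrA modzMDl.
Qed.

Lemma residue_mod x n : (x n %% (p%:Z ^+ n))%Z = x n.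
Proof. by rewrite residueE modz_mod. Qed.

Lemma padic_eqP x y : (forall n, x n = y n) -> x = y.
Proof. by move=> h; apply/val_inj/funext. Qed.

Fact coherent_const (a : int) : `[< coherent p (reduce p (fun=> a)) >].
Proof. by apply/asboolP => n; rewrite /reduce dvdz_modz_pow. Qed.

Fact coherent_add x y : `[< coherent p (reduce p (fun n => x n + y n)) >].
Proof.
apply/asboolP => n; rewrite /reduce dvdz_modz_pow.
by rewrite (residueE x n) (residueE y n) modzDm.
Qed.

Fact coherent_opp x : `[< coherent p (reduce p (fun n => - x n)) >].
Proof.
by apply/asboolP => n; rewrite /reduce dvdz_modz_pow (residueE x n) modzNm.
Qed.

Fact coherent_mul x y : `[< coherent p (reduce p (fun n => x n * y n)) >].
Proof.
apply/asboolP => n; rewrite /reduce dvdz_modz_pow.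
by rewrite (residueE x n) (residueE y n) modzMm.
Qed.

Definition padic_const (a : int) := PadicInt (coherent_const a).
Definition padic_add x y := PadicInt (coherent_add x y).
Definition padic_opp x := PadicInt (coherent_opp x).
Definition padic_mul x y := PadicInt (coherent_mul x y).

Fact padic_addA : associative padic_add.
Proof.
by move=> x y z; apply: padic_eqP => n /=; rewrite /reduce modzDml modzDmr addrA.
Qed.

Fact padic_addC : commutative padic_add.
Proof. by move=> x y; apply: padic_eqP => n /=; rewrite /reduce addrC. Qed.

Fact padic_add0 : left_id (padic_const 0) padic_add.
Proof.
by move=> x; apply: padic_eqP => n /=; rewrite /reduce mod0z add0r residue_mod.
Qed.

Fact padic_addN : left_inverse (padic_const 0) padic_opp padic_add.
Proof.
by move=> x; apply: padic_eqP => n /=; rewrite /reduce modzDml addNr.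
Qed.

HB.instance Definition _ := GRing.isZmodule.Build (padic_int p)
  padic_addA padic_addC padic_add0 padic_addN.

Fact padic_mulA : associative padic_mul.
Proof.
by move=> x y z; apply: padic_eqP => n /=; rewrite /reduce modzMml modzMmr mulrA.
Qed.

Fact padic_mulC : commutative padic_mul.
Proof. by move=> x y; apply: padic_eqP => n /=; rewrite /reduce mulrC. Qed.

Fact padic_mul1 : left_id (padic_const 1) padic_mul.
Proof.
by move=> x; apply: padic_eqP => n /=; rewrite /reduce modzMml mul1r residue_mod.
Qed.

Fact padic_mulDl : left_distributive padic_mul padic_add.
Proof.
by move=> x y z; apply: padic_eqP => n /=; rewrite /reduce modzMml modzDm mulrDl.
Qed.

HB.instance Definition _ := GRing.Zmodule_isComPzRing.Build (padic_int p)
  padic_mulA padic_mulC padic_mul1 padic_mulDl.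

End PadicRing.

(* For [x != 0], the largest [n] such that [x] vanishes modulo p^n. *)
Definition padic_val (p : nat) (x : padic_int p) : nat :=
  if pselect (exists n, x n.+1 != 0) is left h then ex_minn h else 0%N.

Definition padic_norm (R : realType) (p : nat) (x : padic_int p) : R :=
  if x == 0 then 0 else p%:R ^- padic_val x.

Lemma natr_residue (p m n : nat) :
  (m%:R : padic_int p) n = (m%:Z %% (p%:Z ^+ n))%Z.
Proof.
elim: m => [//|m IHm]; rewrite -addn1 natrD /= /reduce IHm modzDm.
by rewrite -PoszD.
Qed.

Lemma padic_normX (R : realType) (p : nat) (p_pr : prime p) (k : nat) :
  padic_norm R ((p%:R : padic_int p) ^+ k) = p%:R ^- k.
Proof.
have p_gt1 := prime_gt1 p_pr.
have rE n : ((p%:R : padic_int p) ^+ k) n = (((p ^ k)%N %% p ^ n)%N : int).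
  by rewrite -natrX natr_residue -[p%:Z]natz -natrX natz modz_nat.
have nz : ((p%:R : padic_int p) ^+ k) k.+1 != 0.
  by rewrite rE modn_small ?ltn_exp2l// eqz_nat -lt0n expn_gt0 prime_gt0.
rewrite /padic_norm; case: eqP => [x0|_].
  by move: nz; rewrite x0 /= /reduce mod0z eqxx.
congr (_ ^- _); rewrite /padic_val; case: pselect => [h|]; last by case; exists k.
case: ex_minnP => n n_nz n_min; apply/eqP; rewrite eqn_leq n_min// leqNgt.
apply/negP => lt_nk; move: n_nz; rewrite rE.
by have /dvdnP[q ->] := dvdn_exp2l p lt_nk; rewrite modnMl eqxx.
Qed.

Section SelfSimilarString.
Variables (R : realType) (p : nat).
Local Notation Zp := (padic_int p).
Local Notation "`| x |_p" := (padic_norm R x) (at level 0, format "`| x |_p").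

Definition affine_similarity_contraction (Phi : Zp -> Zp) (r : R) : Prop :=
  [/\ exists a b : Zp, forall x, Phi x = a * x + b,
      0 < r < 1 &
      forall x y, `| Phi x - Phi y |_p = r * `| x - y |_p].

Definition is_padic_ball (B : set Zp) : Prop :=
  exists (c : Zp) (rho : R), 0 < rho /\ B = [set x | `| x - c |_p <= rho].

Definition convex_component (S B : set Zp) : Prop :=
  [/\ is_padic_ball B, B `<=` S &
      forall B', is_padic_ball B' -> B `<=` B' -> B' `<=` S -> B' = B].

Definition word_map (N : nat) (Phi : 'I_N -> Zp -> Zp) (w : seq 'I_N) : Zp -> Zp :=
  fun x => foldl (fun y j => Phi j y) x w.

Record self_similar_system (N K : nat) (Phi : 'I_N -> Zp -> Zp)
    (r : 'I_N -> R) (G : 'I_K -> set Zp) : Prop := {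
  two_maps : (2 <= N)%N;
  contractions : forall j, affine_similarity_contraction (Phi j) (r j);
  ratios_nonincreasing : forall i j : 'I_N, (i <= j)%N -> r j <= r i;
  ratios_sum : \sum_j r j < 1;
  images_disjoint : trivIset [set: 'I_N] (fun j => range (Phi j));
  one_generator : (1 <= K)%N;
  generators_injective : injective G;
  generatorsP : forall B : set Zp,
    convex_component (~` \bigcup_(j in [set: 'I_N]) range (Phi j)) B
      <-> exists k, B = G k }.

Definition system_string (N K : nat) (Phi : 'I_N -> Zp -> Zp)
    (G : 'I_K -> set Zp) : set Zp :=
  \bigcup_(w in [set: seq 'I_N]) \bigcup_(k in [set: 'I_K])
    (word_map Phi w @` G k).

Definition self_similar_string (N : nat) (L : set Zp) (r : 'I_N -> R) : Prop :=
  exists (K : nat) (Phi : 'I_N -> Zp -> Zp) (G : 'I_K -> set Zp),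
    self_similar_system Phi r G /\ L = system_string Phi G.

End SelfSimilarString.

Section Lattice.
Variable R : realType.

Definition positive_mul_subgroup (H : set R) : Prop :=
  [/\ forall x, H x -> 0 < x, H 1,
      forall x y, H x -> H y -> H (x * y) & forall x, H x -> H x^-1].

Definition generated_mul_group (A : set R) : set R :=
  smallest positive_mul_subgroup A.

(* Isolation of each point is taken in R; since (0, +oo) is open in R, this is
   the same as isolation in (0, +oo). *)
Definition discrete_set (A : set R) : Prop := A `<=` isolated A.

Definition lattice (N : nat) (r : 'I_N -> R) : Prop :=
  discrete_set (generated_mul_group (range r)).

End Lattice.

(* Main.v *)
(* Since |1|_p = 1, the scaling ratio of a similarity Phi equals
   |Phi(1) - Phi(0)|_p, a nonzero value of the p-adic norm and hence an integral
   power of p; a set of integral powers of p is discrete. *)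
Require Import Defs.
From mathcomp Require Import all_boot all_order all_algebra.
From mathcomp Require Import all_classical all_reals all_analysis.
From mathcomp Require Import zify.
Set Implicit Arguments.
Unset Strict Implicit.
Unset Printing Implicit Defensive.
Import Order.TTheory GRing.Theory Num.Theory.
Import numFieldNormedType.Exports.
Local Open Scope classical_set_scope.
Local Open Scope ring_scope.

Lemma similarity_ratio_norm (R : realType) (p : nat) (p_prime : prime p)
    (Phi : padic_int p -> padic_int p) (r : R) :
  affine_similarity_contraction Phi r ->
  exists n : nat, r = p%:R ^- n.
Proof.
case=> _ /andP[r_gt0 _] /(_ 1 0).
(* Reading 1 as [p%:R ^+ 0] lets [padic_normX] evaluate its norm to 1. *)
rewrite subr0 -[1](expr0 p%:R) (padic_normX R p_prime 0) expr0 invr1 mulr1.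
move=> normE; move: r_gt0; rewrite -normE /padic_norm.
(* The zero branch of [padic_norm] would give a ratio equal to 0, against [r_gt0]; the other branch
   is a power of p by definition. *)
case: eqP => [_|_ _]; first by rewrite ltxx.
by eexists.
Qed.

Lemma range_exprz_subgroup (R : realType) (b : R) :
  0 < b -> positive_mul_subgroup (range (fun z : int => b ^ z)).
Proof.
move=> b_gt0; split.
- by move=> _ [z _ <-]; rewrite exprz_gt0.
- by exists 0.
- by move=> _ _ [y _ <-] [z _ <-]; exists (y + z) => //; rewrite expfzDr ?gt_eqF.
- by move=> _ [z _ <-]; exists (- z) => //; rewrite -invr_expz.
Qed.

(** The open interval between the two neighbouring powers [b ^ (z - 1)] and [b ^ (z + 1)] isolates
    [b ^ z], since exponents are integers and [b ^ z] is strictly increasing in z. *)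
Lemma discrete_sub_range_exprz (R : realType) (b : R) (A : set R) :
  1 < b -> A `<=` range (fun z : int => b ^ z) -> discrete_set A.
Proof.
move=> b_gt1 sA x Ax.
have [z _ xE] := sA x Ax.
have lt_z (i j : int) : b ^ i < b ^ j -> i < j by rewrite ltr_eXz2l.
have x_itv : x \in `]b ^ (z - 1), b ^ (z + 1)[%R.
  by rewrite in_itv /= -xE !ltr_eXz2l// ltrBlDr !ltrDl.
split; first exact: mem_set.
exists [set` `]b ^ (z - 1), b ^ (z + 1)[].
  exact: near_in_itvoo x_itv.
apply/seteqP; split=> [y|_ -> //].
case=> + Ay; have [m _ <-] := sA y Ay.
rewrite /= in_itv /= => /andP[/lt_z zm /lt_z mz].
by rewrite -xE; congr (_ ^ _); lia.
Qed.

Theorem theorem4p10 (R : realType) (p : nat) (p_prime : prime p) (N : nat)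
    (L : set (padic_int p)) (r : 'I_N -> R) :
  self_similar_string L r -> lattice r.
Proof.
move=> [K [Phi [G [sys _]]]].
have p_gt1 : 1 < p%:R :> R by rewrite ltr1n prime_gt1.
apply: (discrete_sub_range_exprz p_gt1).
(* By minimality, the generated group lies within the integral powers of p once these form a
   positive subgroup containing every ratio. *)
apply: smallest_sub.
  exact: range_exprz_subgroup (lt_trans ltr01 p_gt1).
move=> _ [j _ <-].
have [n ->] := similarity_ratio_norm p_prime (contractions sys j).
by exists (- n%:Z) => //; rewrite exprnN.
Qed.
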